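(* Let $R$ be a left Ore domain, let $Q^{n,n}_{\mathbf{q},\sigma}(R)=R_{\mathbf{q},\sigma}[x_1^{\pm1},\ldots,x_n^{\pm1}]$ be an $n$-multiparametric skew quantum torus over $R$, let $\nu: Q(Q^{n,n}_{\mathbf{q},\sigma}(R))^*\rightarrow\Gamma$ be a valuation with $\nu(Q(R)^* )=0$, and suppose that $Q^{n,n}_{\widetilde{\mathbf{q}},\widetilde{\sigma}}(Q(R))$ is generic. Then the valuation $\nu$ has maximal rank if and only if $\Gamma\cong\mathbb{Z}^n$.
   Context: Rings are associative with $1$; $R^*$ is the group of units of $R$. Skew quantum torus: let $n\ge 2$, let $\mathbf{q}=[q_{ij}]\in M_n(R)$ satisfy $q_{ii}=1=q_{ij}q_{ji}=q_{ji}q_{ij}$ for all $1\le i,j\le n$, and let $\sigma=(\sigma_1,\ldots,\sigma_n)$ be automorphisms of $R$. The ring $Q^{n,n}_{\mathbf{q},\sigma}(R):=R_{\mathbf{q},\sigma}[x_1^{\pm1},\ldots,x_n^{\pm1}]$ is a ring containing $R$ as a subring, which is a free left $R$-module with basis $\{x^u=x_1^{u_1}\cdots x_n^{u_n} : u\in\mathbb{Z}^n\}$, and in which $x_ix_i^{-1}=1=x_i^{-1}x_i$, $x_ix_j=q_{ji}x_jx_i$, and $x_ir=\sigma_i(r)x_i$ for all $r\in R$ and $1\le i,j\le n$ (the data $\mathbf{q},\sigma$ are assumed such that this ring exists). For a left Ore domain $B$, $Q(B)$ denotes its total division ring of (left) fractions. When $R$ is a left Ore domain so is $Q^{n,n}_{\mathbf{q},\sigma}(R)$,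 and $Q(R)$ is regarded as a division subring of $Q(Q^{n,n}_{\mathbf{q},\sigma}(R))$. Each $\sigma_i$ extends to the automorphism $\widetilde\sigma_i$ of $Q(R)$ given by $\widetilde\sigma_i(b^{-1}a)=\sigma_i(b)^{-1}\sigma_i(a)$; put $\widetilde\sigma=(\widetilde\sigma_1,\ldots,\widetilde\sigma_n)$ and let $\widetilde{\mathbf{q}}=(q_{ij}/1)\in M_n(Q(R))$. Then $Q^{n,n}_{\widetilde{\mathbf{q}},\widetilde\sigma}(Q(R))$ is the skew quantum torus over $Q(R)$ with these data. Generic: let $N$ be the subgroup of $Q(R)^*$ generated by the derived subgroup $[Q(R)^*,Q(R)^*]$ and all elements $z^{-1}\widetilde\sigma_i(z)$, $z\in Q(R)^*$, $1\le i\le n$. The ring $Q^{n,n}_{\widetilde{\mathbf{q}},\widetilde\sigma}(Q(R))$ is generic if the images of the $q_{ij}/1$, $1\le i<j\le n$, are (multiplicatively) independent in the abelian group $Q(R)^*/N$. Valuation: for a division ring $D$ and a totally ordered group $\Gamma$ (written additively, not necessarily commutative), a valuation $\nu:D^*\to\Gamma$ is a surjective map with $\nu(ab)=\nu(a)+\nu(b)$ for all $a,b\in D^*$ and $\nu(a+b)\ge\min\{\nu(a),\nu(b)\}$ whenever $a,b,a+b\in D^*$. Maximal rank: for valuations $\nu_1:D^*\to\Gamma_1$ and $\nu_2:D^*\to\Gamma_2$, write $\nu_1\ge\nu_2$ if there is an epimorphism of ordered groups $\tau:\Gamma_1\to\Gamma_2$ with $\tau\nu_1=\nu_2$. Here the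 valuations considered on $D=Q(Q^{n,n}_{\mathbf{q},\sigma}(R))$ are those vanishing on $Q(R)^*$. A valuation $\nu$ has maximal rank if, whenever $\nu_1\ge\nu$ via $\tau$, the map $\tau$ is an isomorphism. *)

(* Defs.v *)
From HB Require Import structures.
From mathcomp Require Import all_boot all_order all_algebra.

Set Implicit Arguments.
Unset Strict Implicit.
Unset Printing Implicit Defensive.

Import Order.TTheory GRing.Theory Num.Theory.
Local Open Scope ring_scope.

(* A totally ordered, not necessarily commutative, group. The group law is
   the multiplicative one of MathComp's [groupType], so the additive 0, a + b
   of the value group of a valuation read 1%g, (a * b)%g. *)
HB.mixin Record isOrderedGroup (d : Order.disp_t) (G : Type)
    of monoid.Group G & Order.Total d G := {
  le_mulg2l : forall z x y : G, (x <= y)%O -> (z * x <= z * y)%O%g;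
  le_mulg2r : forall z x y : G, (x <= y)%O -> (x * z <= y * z)%O%g
}.

#[short(type="orderedGroupType")]
HB.structure Definition OrderedGroup (d : Order.disp_t) :=
  {G of isOrderedGroup d G & monoid.Group G & Order.Total d G}.

Section OreDomains.

Definition left_Ore_domain (R : nzRingType) : Prop :=
  (forall a b : R, a != 0 -> b != 0 -> a * b != 0) /\
  (forall a b : R, a != 0 -> b != 0 ->
     exists r s : R, r * a = s * b /\ r * a != 0).

Definition division_ring (D : unitRingType) : Prop :=
  forall z : D, z != 0 -> z \is a GRing.unit.

(* [D], with the embedding [f], is the division ring Q(B) of left fractions
   of [B]; this determines [D] up to a unique isomorphism over [B]. *)
Definition left_fraction_ring (B : nzRingType) (D : unitRingType)
    (f : {rmorphism B -> D}) : Prop :=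
  [/\ division_ring D, injective f &
      forall z : D, exists a b : B, b != 0 /\ z = (f b)^-1 * f a].

Definition fraction_extension (R : nzRingType) (K : unitRingType)
    (f : {rmorphism R -> K})
    (s : {rmorphism R -> R}) (sK : {rmorphism K -> K}) : Prop :=
  bijective sK /\
  forall a b : R, b != 0 -> sK ((f b)^-1 * f a) = (f (s b))^-1 * f (s a).

End OreDomains.

Section SkewQuantumTorus.

(* Big products over ['I_n] are taken in increasing order of the index. *)
Definition torus_monomial (T : unitRingType) (n : nat) (x : 'I_n -> T)
    (u : 'rV[int]_n) : T :=
  \prod_(i < n) x i ^ u 0 i.

(* [T], with the embedding [f] of [R] and the variables [x], is the skew
   quantum torus R_{q, sigma}[x_1^{+-1}, ..., x_n^{+-1}]. *)
Record skew_quantum_torus (n : nat) (R : nzRingType)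
    (q : 'M[R]_n) (sigma : 'I_n -> {rmorphism R -> R})
    (T : unitRingType) (f : {rmorphism R -> T}) (x : 'I_n -> T) : Prop :=
  SkewQuantumTorus {
    sqt_diag : forall i, q i i = 1;
    sqt_inv : forall i j, q i j * q j i = 1;
    sqt_auto : forall i, bijective (sigma i);
    sqt_inj : injective f;
    sqt_unit : forall i, x i \is a GRing.unit;
    sqt_comm : forall i j, x i * x j = f (q j i) * x j * x i;
    sqt_skew : forall i r, x i * f r = f (sigma i r) * x i;
    sqt_span : forall t : T, exists (s : seq 'rV[int]_n) (c : 'rV[int]_n -> R),
      t = \sum_(u <- s) f (c u) * torus_monomial x u;
    sqt_free : forall (s : seq 'rV[int]_n) (c : 'rV[int]_n -> R), uniq s ->
      \sum_(u <- s) f (c u) * torus_monomial x u = 0 ->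
      forall u, u \in s -> c u = 0
  }.

End SkewQuantumTorus.

Section Generic.

(* The subgroup of K^* generated by a set [S] of units. *)
Inductive generated_subgroup (K : unitRingType) (S : K -> Prop) : K -> Prop :=
| gen_one : generated_subgroup S 1
| gen_elt z : S z -> generated_subgroup S z
| gen_mul y z : generated_subgroup S y -> generated_subgroup S z ->
    generated_subgroup S (y * z)
| gen_inv z : generated_subgroup S z -> generated_subgroup S z^-1.

Definition derived_subgroup (K : unitRingType) : K -> Prop :=
  generated_subgroup (fun z : K => exists a b : K,
    [/\ a \is a GRing.unit, b \is a GRing.unit & z = a^-1 * b^-1 * a * b]).

Definition torus_N (K : unitRingType) (n : nat)
    (sigma : 'I_n -> {rmorphism K -> K}) : K -> Prop :=
  generated_subgroup (fun z : K => derived_subgroup z \/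
    exists (i : 'I_n) (y : K), y \is a GRing.unit /\ z = y^-1 * sigma i y).

(* Genericity of the skew quantum torus over the division ring [K] with data
   [q], [sigma]: a product of powers of the classes of the [q i j] is trivial
   in K^*/N if and only if the product of powers of the [q i j] lies in N. The
   order of the factors is immaterial, since N contains the commutators. *)
Definition generic_torus (K : unitRingType) (n : nat) (q : 'M[K]_n)
    (sigma : 'I_n -> {rmorphism K -> K}) : Prop :=
  forall m : 'I_n -> 'I_n -> int,
    torus_N sigma (\prod_(i < n) \prod_(j < n | (i < j)%N) q i j ^ m i j) ->
    forall i j : 'I_n, (i < j)%N -> m i j = 0.

End Generic.

Section Valuations.

(* A valuation D^* -> G is represented by a function on [D] whose value at 0
   is irrelevant. *)
Definition valuation (D : unitRingType) (d : Order.disp_t)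
    (G : orderedGroupType d) (nu : D -> G) : Prop :=
  [/\ forall g : G, exists2 a : D, a \is a GRing.unit & nu a = g,
      forall a b : D, a \is a GRing.unit -> b \is a GRing.unit ->
        nu (a * b) = (nu a * nu b)%g &
      forall a b : D, a \is a GRing.unit -> b \is a GRing.unit ->
        a + b \is a GRing.unit -> (Order.min (nu a) (nu b) <= nu (a + b))%O].

Definition vanishes_on (K D : unitRingType) (j : {rmorphism K -> D})
    (d : Order.disp_t) (G : orderedGroupType d) (nu : D -> G) : Prop :=
  forall z : K, z \is a GRing.unit -> nu (j z) = 1%g.

Definition ordered_epi (d1 d2 : Order.disp_t) (G1 : orderedGroupType d1)
    (G2 : orderedGroupType d2) (tau : {multiplicative G1 -> G2}) : Prop :=
  {homo tau : x y / (x <= y)%O} /\ (forall g2 : G2, exists g1 : G1, tau g1 = g2).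

Definition ordered_iso (d1 d2 : Order.disp_t) (G1 : orderedGroupType d1)
    (G2 : orderedGroupType d2) (tau : {multiplicative G1 -> G2}) : Prop :=
  {homo tau : x y / (x <= y)%O} /\
  exists tau' : {multiplicative G2 -> G1},
    [/\ {homo tau' : x y / (x <= y)%O}, cancel tau tau' & cancel tau' tau].

Definition valuation_ge_via (D : unitRingType) (d1 d2 : Order.disp_t)
    (G1 : orderedGroupType d1) (G2 : orderedGroupType d2)
    (nu1 : D -> G1) (nu2 : D -> G2) (tau : {multiplicative G1 -> G2}) : Prop :=
  ordered_epi tau /\ (forall a : D, a \is a GRing.unit -> tau (nu1 a) = nu2 a).

(* The competing valuations are those vanishing on the image of K^* in D^*. *)
Definition maximal_rank (K D : unitRingType) (j : {rmorphism K -> D})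
    (d : Order.disp_t) (G : orderedGroupType d) (nu : D -> G) : Prop :=
  forall (d1 : Order.disp_t) (G1 : orderedGroupType d1) (nu1 : D -> G1)
    (tau : {multiplicative G1 -> G}),
    valuation nu1 -> vanishes_on j nu1 -> valuation_ge_via nu1 nu tau ->
    ordered_iso tau.

(* An isomorphism of groups; no order on Z^n is prescribed. *)
Definition isomorphic_to_Zn (d : Order.disp_t) (G : orderedGroupType d)
    (n : nat) : Prop :=
  exists f : G -> 'rV[int]_n,
    bijective f /\ (forall a b : G, f (a * b)%g = f a + f b).

End Valuations.

(* Main.v *)
Require Import Defs.
From HB Require Import structures.
From mathcomp Require Import all_boot all_order all_algebra.
From Stdlib Require ClassicalEpsilon.

Set Implicit Arguments.
Unset Strict Implicit.
Unset Printing Implicit Defensive.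

Import Order.TTheory GRing.Theory Num.Theory.
Local Open Scope ring_scope.

(** Let [X u] denote the ordered monomials, seen in [D]. A valuation that is
    trivial on the coefficients sends them to commuting elements of the value
    group, because [X u * X v] and [X v * X u] differ by a coefficient; so the
    map from [u] to [nu (X u)] is a homomorphism phi from Z^n to [G]
    ([valuation_monomialD]).

    The main point is that genericity rules out any cancellation: the value of a
    sum of distinct monomials with nonzero coefficients is the least value of its
    terms ([generic_valuation_terms], [lowest_value]). If the value of a sum
    exceeds that of one of its terms, one eliminates this term by subtracting a
    multiple of the sum from its conjugate by a variable. The other terms do not
    disappear: conjugation by the i-th variable multiplies the term of exponent
    [u] by a factor which, modulo the subgroup N of the definition of genericity,
    is the product of the powers [q k i ^ u k], and these products, taken for all
    i, determine [u] as soon as there are at least two variables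
    ([generic_twists], [generic_exponent_eq0]). Induction on the number of terms
    then places every other term above the bound, hence also the eliminated one, a
    contradiction.

    Consequently phi is onto [G] ([monomial_value_surj]): the value group of
    every valuation considered is a quotient of Z^n.

    If [G] is isomorphic to Z^n, then phi is a surjective endomorphism of Z^n up
    to this isomorphism, hence injective. For a valuation [nu1] above [nu] via
    tau, the analogous map phi1 is onto the group of [nu1] and satisfies
    tau phi1 = phi, so that tau is injective ([lattice_maximal_rank]).

    Conversely, order Z^n by the values of phi first, and lexicographically among
    exponents of equal value. Taking the exponent of the lowest term defines a
    valuation on the quantum torus, since its coefficients form a domain, and this
    valuation extends to fractions ([monomial_valuation]). It lies above [nu] via
    phi, so that maximality of [nu] makes phi an isomorphism
    ([maximal_rank_lattice]). *)

(** * Units modulo a normalized subgroup *)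

Section UnitSubgroups.
Variable U : unitRingType.

Record unit_subgroup (P : U -> Prop) : Prop := UnitSubgroup {
  ugrp_unit : forall a, P a -> a \is a GRing.unit;
  ugrp_1 : P 1;
  ugrp_M : forall a b, P a -> P b -> P (a * b);
  ugrp_V : forall a, P a -> P a^-1
}.

Lemma ugrp_Xz (P : U -> Prop) a (k : int) : unit_subgroup P -> P a -> P (a ^ k).
Proof.
move=> [_ P1 PM PV] Pa.
have PX m : P (a ^+ m) by elim: m => [|m IH]; rewrite ?expr0 ?exprS //; apply: PM.
by case: k => m; [apply: PX | apply/PV/PX].
Qed.

Lemma ugrp_prod (P : U -> Prop) (I : Type) (r : seq I) (F : I -> U) :
  unit_subgroup P -> (forall i, P (F i)) -> P (\prod_(i <- r) F i).
Proof.
move=> [_ P1 PM _] PF; elim: r => [|i r IH]; rewrite ?big_nil ?big_cons //.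
exact: PM.
Qed.

Variables (M W : U -> Prop).
Hypotheses (gM : unit_subgroup M) (gW : unit_subgroup W).
Hypothesis nM : forall w m, W w -> M m -> M (w * m * w^-1).

(** Congruence of units modulo [M], for elements of a group [W] normalizing [M].
    It serves twice: in the quantum torus, where the variables commute modulo the
    units of the coefficients, and in [K^*] modulo the subgroup that defines
    genericity, where everything commutes. *)
Definition cong a b : Prop := M (a * b^-1).

Lemma cong_refl a : W a -> cong a a.
Proof. by move=> Wa; rewrite /cong divrr ?(ugrp_unit gW) //; apply: ugrp_1. Qed.

Local Ltac inW := by repeat first
  [ assumption | apply: (ugrp_M gW) | apply: (ugrp_V gW) | apply: cong_refl ].

Lemma cong_sym a b : W a -> W b -> cong a b -> cong b a.
Proof.
move=> /(ugrp_unit gW) ua /(ugrp_unit gW) ub /(ugrp_V gM).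
by rewrite invrM ?unitrV // invrK.
Qed.

Lemma cong_trans b a c : W b -> cong a b -> cong b c -> cong a c.
Proof.
move=> /(ugrp_unit gW) ub Hab /(ugrp_M gM Hab).
by rewrite mulrA mulrVK.
Qed.

Lemma cong_mul a b c d : W a -> W b -> W c -> W d ->
  cong a b -> cong c d -> cong (a * c) (b * d).
Proof.
move=> Wa Wb Wc Wd Hab Hcd; have /(_ gM) := ugrp_M _ (nM Wa Hcd) Hab.
have [ua ub ud] : [/\ a \is a GRing.unit, b \is a GRing.unit & d \is a GRing.unit].
  by split; apply: (ugrp_unit gW).
by rewrite /cong invrM // !mulrA mulrVK.
Qed.

Lemma cong_inv a b : W a -> W b -> cong a b -> cong a^-1 b^-1.
Proof.
move=> Wa Wb /(cong_sym Wa Wb) /(nM (ugrp_V gW Wa)).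
by rewrite /cong !invrK mulrA mulrVK // (ugrp_unit gW).
Qed.

Definition commutes a b : Prop := cong (a * b) (b * a).

Lemma commutes_sym a b : W a -> W b -> commutes a b -> commutes b a.
Proof. by move=> Wa Wb; apply: cong_sym; apply: ugrp_M. Qed.

Lemma commutes_subgroup a : W a ->
  unit_subgroup (fun b => W b /\ commutes a b).
Proof.
move=> Wa; have WM := ugrp_M gW; split => [b [Wb _]||b c [Wb Hb] [Wc Hc]|b [Wb Hb]].
- exact: (ugrp_unit gW).
- by split; [exact: (ugrp_1 gW)|rewrite /commutes mulr1 mul1r; apply: cong_refl].
- split; first exact: WM.
  apply: (@cong_trans (b * a * c)); rewrite ?mulrA; first inW.
    by apply: cong_mul; inW.
  by rewrite -!mulrA; apply: cong_mul; inW.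
- have Wb' := ugrp_V gW Wb; have ub := ugrp_unit gW Wb.
  split=> //; have Hba := commutes_sym Wa Wb Hb.
  have H : cong (b^-1 * (b * a) * b^-1) (b^-1 * (a * b) * b^-1).
    by apply: cong_mul; first [inW | apply: cong_mul; inW].
  by move: H; rewrite /commutes mulrA mulVr // mul1r -!mulrA mulrV // mulr1.
Qed.

Lemma commutes_Xz a b k l : W a -> W b -> commutes a b -> commutes (a ^ k) (b ^ l).
Proof.
move=> Wa Wb Hab.
have [Wbl Habl] := ugrp_Xz l (commutes_subgroup Wa) (conj Wb Hab).
have [Wak Hak] := ugrp_Xz k (commutes_subgroup Wbl) (conj Wa (commutes_sym Wa Wbl Habl)).
exact: commutes_sym.
Qed.

Section Monomials.
Variables (I : Type) (x : I -> U).
Hypotheses (Wx : forall i, W (x i)) (Cx : forall i k, commutes (x i) (x k)).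

Lemma cong_prodM (r : seq I) (F H : I -> U) :
  (forall i, W (F i)) -> (forall i, W (H i)) ->
  (forall i k, commutes (F i) (H k)) ->
  cong (\prod_(i <- r) (F i * H i))
       ((\prod_(i <- r) F i) * (\prod_(i <- r) H i)).
Proof.
move=> WF WH CFH; have WM := ugrp_M gW.
have Wprod := ugrp_prod _ gW.
elim: r => [|i r IH]; first by rewrite !big_nil mulr1; apply/cong_refl/(ugrp_1 gW).
rewrite !big_cons; set A := \prod_(k <- r) F k; set B := \prod_(k <- r) H k.
have WA : W A by apply: Wprod.
have WB : W B by apply: Wprod.
have WAB : W (\prod_(k <- r) (F k * H k)) by apply: Wprod => k; apply: WM.
have [_ CA] : W A /\ commutes (H i) A.
  by apply: (ugrp_prod _ (commutes_subgroup (WH i))) => k; split=> //; apply: commutes_sym.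
apply: (@cong_trans (F i * H i * (A * B))); first inW.
  by apply: cong_mul; inW.
rewrite -!mulrA; apply: cong_mul; try inW.
by rewrite !mulrA; apply: cong_mul; inW.
Qed.

(** Since the [x i] commute modulo [M], an ordered monomial depends on its
    exponent vector, up to [M], as a homomorphism. *)
Lemma cong_monomialD (r : seq I) (u v : I -> int) :
  cong (\prod_(i <- r) x i ^ (u i + v i))
       ((\prod_(i <- r) x i ^ u i) * (\prod_(i <- r) x i ^ v i)).
Proof.
have WX i k : W (x i ^ k) by apply: ugrp_Xz.
under eq_bigr => i _ do rewrite exprzDr ?(ugrp_unit gW) //.
by apply: cong_prodM => // i k; apply: commutes_Xz.
Qed.

End Monomials.
End UnitSubgroups.

(** * Monomials in skew-commuting variables *)

Section SkewMonomials.
Variables (A : nzRingType) (T : unitRingType) (f : {rmorphism A -> T}).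
Hypothesis f_inj : injective f.

Definition invertible (a : A) : Prop := exists b, a * b = 1 /\ b * a = 1.
Definition unit_scalar (t : T) : Prop := exists2 a, invertible a & t = f a.
Definition normalizes (w : T) : Prop :=
  [/\ w \is a GRing.unit, forall a, exists b, w * f a = f b * w
    & forall a, exists b, f a * w = w * f b].

Lemma unit_scalar_unit a : invertible a -> f a \is a GRing.unit.
Proof.
case=> b [ab ba]; apply/unitrP; exists (f b).
by rewrite -!rmorphM ab ba rmorph1.
Qed.

Lemma invertible_neq0M a b : invertible a -> b != 0 -> b * a != 0.
Proof.
case=> c [ac _]; apply: contraNneq => ba0.
by rewrite -[b]mulr1 -ac mulrA ba0 mul0r.
Qed.

Lemma unit_scalar_subgroup : unit_subgroup unit_scalar.
Proof.
split=> [_ [a ia ->]||_ _ [a [a' [aa' a'a]] ->] [b [b' [bb' b'b]] ->]|_ [a ia ->]].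
- exact: unit_scalar_unit.
- by exists 1; rewrite ?rmorph1 //; exists 1; rewrite mulr1.
- exists (a * b); rewrite ?rmorphM //; exists (b' * a').
  by rewrite -mulrA [b * _]mulrA bb' mul1r -mulrA [a' * _]mulrA a'a mul1r.
- have ua := unit_scalar_unit ia; case: ia => b [ab ba].
  exists b; first by exists a.
  by apply: (mulrI ua); rewrite mulrV // -rmorphM ab rmorph1.
Qed.

Lemma normalizes_subgroup : unit_subgroup normalizes.
Proof.
split=> [w []||w z [uw wl wr] [uz zl zr]|w [uw wl wr]] //.
- by split=> [|a|a]; rewrite ?unitr1 //; exists a; rewrite mulr1 mul1r.
- split=> [|a|a]; first by rewrite unitrMl.
  + have [b Hb] := zl a; have [c Hc] := wl b.
    by exists c; rewrite -mulrA Hb mulrA Hc mulrA.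
  + have [b Hb] := wr a; have [c Hc] := zr b.
    by exists c; rewrite mulrA Hb -mulrA Hc mulrA.
- split=> [|a|a]; rewrite ?unitrV //.
  + have [b Hb] := wr a; exists b.
    by apply: (mulrI uw); rewrite mulrA mulrV // mul1r mulrA -Hb mulrK.
  + have [b Hb] := wl a; exists b.
    by apply: (mulIr uw); rewrite mulrVK // -mulrA -Hb mulrA mulVr // mul1r.
Qed.

Lemma normalizes_conj w m : normalizes w -> unit_scalar m ->
  unit_scalar (w * m * w^-1).
Proof.
case=> uw wl _ [a [b [ab ba]] ->].
have [a' Ha] := wl a; have [b' Hb] := wl b.
exists a'; last by rewrite Ha mulrK.
exists b'; split; apply/f_inj/(mulIr uw); rewrite rmorph1 rmorphM -mulrA.
  by rewrite -Hb mulrA -Ha -mulrA -rmorphM ab rmorph1 mul1r mulr1.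
by rewrite -Ha mulrA -Hb -mulrA -rmorphM ba rmorph1 mul1r mulr1.
Qed.

Lemma normalizes_neq0 w a b : normalizes w -> w * f a = f b * w -> a != 0 -> b != 0.
Proof.
case=> uw _ _ H; apply: contraNneq => b0; apply/eqP/f_inj.
by apply: (mulrI uw); rewrite H b0 !rmorph0 mul0r mulr0.
Qed.

Variables (n : nat) (x : 'I_n -> T) (q : 'M[A]_n) (sigma : 'I_n -> A -> A).
Hypothesis x_unit : forall i, x i \is a GRing.unit.
Hypothesis sigma_bij : forall i, bijective (sigma i).
Hypothesis x_skew : forall i a, x i * f a = f (sigma i a) * x i.
Hypothesis q_inv : forall i k, q i k * q k i = 1.
Hypothesis x_comm : forall i k, x i * x k = f (q k i) * x k * x i.

Local Notation X := (torus_monomial x).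

Lemma variable_normalizes i : normalizes (x i).
Proof.
split=> // a; first by exists (sigma i a).
by case: (sigma_bij i) => g _ gK; exists (g a); rewrite x_skew gK.
Qed.

Lemma variable_commutes i k : commutes unit_scalar (x i) (x k).
Proof.
exists (q k i); first by exists (q i k).
have [ui uk] := (x_unit i, x_unit k).
by rewrite x_comm -[f _ * _ * _]mulrA mulrK // unitrMl.
Qed.

Lemma monomial_normalizes u : normalizes (X u).
Proof.
apply: (ugrp_prod _ normalizes_subgroup) => i.
exact/(ugrp_Xz _ normalizes_subgroup)/variable_normalizes.
Qed.

Lemma monomial_unit u : X u \is a GRing.unit.
Proof. by case: (monomial_normalizes u). Qed.

(** Modulo the units of [A], which the variables normalize, the variables
    commute. *)
Lemma monomialM u v : exists2 a, invertible a & X u * X v = f a * X (u + v).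
Proof.
have := cong_monomialD unit_scalar_subgroup normalizes_subgroup normalizes_conj
  variable_normalizes variable_commutes (index_enum 'I_n) (u 0) (v 0).
have -> : \prod_(i <- index_enum 'I_n) x i ^ (u 0 i + v 0 i) = X (u + v).
  by apply: eq_bigr => i _; rewrite mxE.
move/(cong_sym unit_scalar_subgroup normalizes_subgroup).
move=> /(_ (monomial_normalizes _)) [|a ia E].
  by apply: (ugrp_M normalizes_subgroup); apply: monomial_normalizes.
by exists a => //; rewrite -E mulrVK // monomial_unit.
Qed.

End SkewMonomials.

Lemma torus_monomial0 (T : unitRingType) n (x : 'I_n -> T) :
  torus_monomial x 0 = 1.
Proof. by apply: big1 => i _; rewrite mxE expr0z. Qed.

Lemma torus_monomial_delta (T : unitRingType) n (x : 'I_n -> T) i :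
  torus_monomial x (delta_mx 0 i) = x i.
Proof.
rewrite /torus_monomial (eq_bigr (fun k => if k == i then x k else 1)).
  by rewrite -big_mkcond big_pred1_eq.
by move=> k _; rewrite mxE eqxx /=; case: (k == i); rewrite ?expr1z ?expr0z.
Qed.

(** * Generic parameters separate the exponents *)

Section TwistSubgroup.
Variables (K : unitRingType) (n : nat) (sigma : 'I_n -> {rmorphism K -> K}).
Local Notation N := (torus_N sigma).
Local Notation unitP a := (a \is a GRing.unit).

Let isunit (a : K) : Prop := unitP a.

Lemma units_subgroup : unit_subgroup isunit.
Proof.
by split=> [||a b ua ub|a ua] //; rewrite /isunit ?unitr1 ?unitrMl ?unitrV.
Qed.

Lemma generated_subgroup_units (S : K -> Prop) :
  (forall z, S z -> unitP z) -> unit_subgroup (generated_subgroup S).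
Proof.
move=> SU; split; [|exact: gen_one|exact: gen_mul|exact: gen_inv].
move=> a; elim=> [|z /SU|y z _ uy _ uz|z _ uz] //; first exact: unitr1.
  by rewrite unitrMl.
by rewrite unitrV.
Qed.

Lemma torus_N_subgroup : unit_subgroup N.
Proof.
apply: generated_subgroup_units => z [|[i [y [uy ->]]]]; last first.
  by rewrite unitrMl ?unitrV ?rmorph_unit.
apply/ugrp_unit/generated_subgroup_units => _ [a [b [ua ub ->]]].
by rewrite !unitrMl ?unitrV.
Qed.

Lemma torus_N_commutator a b : unitP a -> unitP b -> N (a * b * a^-1 * b^-1).
Proof.
move=> ua ub; apply: gen_elt; left; apply: gen_elt.
by exists a^-1, b^-1; rewrite !unitrV !invrK.
Qed.

Lemma torus_N_normal w m : isunit w -> N m -> N (w * m * w^-1).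
Proof.
move=> uw Nm; have um := ugrp_unit torus_N_subgroup Nm.
have := ugrp_M torus_N_subgroup (torus_N_commutator uw um) Nm.
by rewrite mulrVK.
Qed.

Local Notation "a == b %[mod_N]" := (cong N a b) (at level 70, b at next level).

Lemma commutes_torus_N a b : unitP a -> unitP b -> commutes N a b.
Proof.
move=> ua ub; rewrite /commutes /cong invrM // mulrA.
exact: torus_N_commutator.
Qed.

Lemma sigma_cong i z : unitP z -> z == sigma i z %[mod_N].
Proof.
move=> uz; have uz' : unitP (sigma i z) by rewrite rmorph_unit.
have : N (z^-1 * sigma i z) by apply: gen_elt; right; exists i, z.
move=> /(ugrp_V torus_N_subgroup) /(torus_N_normal uz).
by rewrite invrM ?unitrV // invrK mulrA mulrK.
Qed.

Variable q : 'M[K]_n.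
Hypothesis q_diag : forall i, q i i = 1.
Hypothesis q_inv : forall i k, q i k * q k i = 1.

Lemma q_unit i k : unitP (q i k).
Proof. by apply/unitrP; exists (q k i). Qed.

Lemma q_sym i k : (q i k)^-1 = q k i.
Proof. by apply: (mulrI (q_unit i k)); rewrite mulrV ?q_unit // q_inv. Qed.

(** The product on the left involves only the pairs containing [i]: those
    [(k, i)] with [k < i] as they stand, and those [(i, k)] with [i < k]
    through [q k i = (q i k)^-1]. *)
Lemma row_exponents i (v : 'rV[int]_n) :
  \prod_(a < n) \prod_(b < n | (a < b)%N)
     q a b ^ (if b == i then v 0 a else if a == i then - v 0 b else 0)
  == \prod_(k < n) q k i ^ v 0 k %[mod_N].
Proof.
pose F (k : 'I_n) := if (k < i)%N then q k i ^ v 0 k else 1.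
pose H (k : 'I_n) := if (i < k)%N then q k i ^ v 0 k else 1.
pose G (k : 'I_n) := if k == i then \prod_(b < n) H b else 1.
have uq k l m : unitP (q k l ^ m) by rewrite unitrXz ?q_unit.
have uF k : isunit (F k) by rewrite /isunit /F; case: ifP; rewrite ?unitr1.
have uH k : isunit (H k) by rewrite /isunit /H; case: ifP; rewrite ?unitr1.
have uprod (P : 'I_n -> K) : (forall k, isunit (P k)) -> isunit (\prod_k P k).
  exact: (ugrp_prod _ units_subgroup).
have uG k : isunit (G k).
  by rewrite /G; case: ifP => _; [apply: uprod | apply: unitr1].
have C (P Q : 'I_n -> K) : (forall k, isunit (P k)) -> (forall k, isunit (Q k)) ->
    \prod_k (P k * Q k) == (\prod_k P k) * (\prod_k Q k) %[mod_N].
  move=> uP uQ; apply: (cong_prodM torus_N_subgroup units_subgroup) => //.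
    exact: torus_N_normal.
  by move=> k l; apply: commutes_torus_N; [apply: uP | apply: uQ].
have -> : \prod_(a < n) \prod_(b < n | (a < b)%N)
     q a b ^ (if b == i then v 0 a else if a == i then - v 0 b else 0)
   = \prod_(a < n) (F a * G a).
  apply: eq_bigr => a _; rewrite big_mkcond /F /G.
  have [->|neq_ai] := eqVneq a i.
    rewrite ltnn mul1r; apply: eq_bigr => b _; rewrite /H.
    have [->|neq_bi] := eqVneq b i; first by rewrite ltnn.
    by rewrite -q_sym exprz_inv opprK.
  rewrite mulr1 (eq_bigr (fun b => if b == i then F a else 1)).
    by rewrite -big_mkcond big_pred1_eq.
  move=> b _; rewrite /F; have [->|neq_bi] := eqVneq b i => //.
  by rewrite expr0z if_same.
have -> : \prod_(k < n) q k i ^ v 0 k = \prod_(k < n) (F k * H k).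
  apply: eq_bigr => k _; rewrite /F /H.
  case: ltngtP => [||/val_inj ->]; rewrite ?mulr1 ?mul1r //.
  by rewrite q_diag exp1rz.
apply: (@cong_trans _ _ _ torus_N_subgroup units_subgroup
         ((\prod_k F k) * (\prod_k H k))).
- by apply: (ugrp_M units_subgroup); apply: uprod.
- have <- : \prod_k G k = \prod_k H k by rewrite /G -big_mkcond big_pred1_eq.
  exact: C.
- apply: (cong_sym torus_N_subgroup units_subgroup).
  + by apply: uprod => k; apply: (ugrp_M units_subgroup).
  + by apply: (ugrp_M units_subgroup); apply: uprod.
  + exact: C.
Qed.

Lemma generic_exponent_eq0 (v : 'rV[int]_n) : (2 <= n)%N -> generic_torus q sigma ->
  (forall i, N (\prod_(k < n) q k i ^ v 0 k)) -> v = 0.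
Proof.
move=> n2 gen Nv; apply/rowP => k; rewrite mxE.
(* Two distinct indices are what makes some q i k, with i != k, available. *)
have [i neq_ik] : exists i : 'I_n, i != k.
  have [->|] := eqVneq k (Ordinal n2); last by rewrite eq_sym; exists (Ordinal n2).
  by exists (Ordinal (ltnW n2)).
set m := fun a b : 'I_n => if b == i then v 0 a else if a == i then - v 0 b else 0.
have mE : forall a b : 'I_n, (a < b)%N -> m a b = 0.
  apply: gen; have := ugrp_M torus_N_subgroup (row_exponents i v) (Nv i).
  rewrite mulrVK //; apply: (ugrp_prod _ units_subgroup) => l.
  by rewrite /isunit unitrXz ?q_unit.
have [lt_ki|lt_ik|/val_inj eq_ki] := ltngtP k i.
- by have := mE _ _ lt_ki; rewrite /m eqxx.
- have := mE _ _ lt_ik; rewrite /m eq_sym (negPf neq_ik) eqxx => /eqP.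
  by rewrite oppr_eq0 => /eqP.
- by rewrite eq_ki eqxx in neq_ik.
Qed.

End TwistSubgroup.

Section Twists.
Variables (K D : unitRingType) (j : {rmorphism K -> D}) (n : nat).
Variables (sigma : 'I_n -> {rmorphism K -> K}) (q : 'M[K]_n) (x : 'I_n -> D).
Hypothesis j_inj : injective j.
Hypothesis x_unit : forall i, x i \is a GRing.unit.
Hypothesis sigma_bij : forall i, bijective (sigma i).
Hypothesis x_skew : forall i a, x i * j a = j (sigma i a) * x i.
Hypothesis q_diag : forall i, q i i = 1.
Hypothesis q_inv : forall i k, q i k * q k i = 1.
Hypothesis x_comm : forall i k, x i * x k = j (q k i) * x k * x i.

Local Notation unitP a := (a \is a GRing.unit).
Local Notation X := (torus_monomial x).
Local Notation N := (torus_N sigma).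
Local Notation "a == b %[mod_N]" := (cong N a b) (at level 70, b at next level).

Let gN := torus_N_subgroup sigma.
Let gU := units_subgroup K.
Let nN := @torus_N_normal _ _ sigma.

(** Normalizers of [K] that act trivially on [K^*/N]. The variables are among
    them because [N] contains the elements [z^-1 * sigma i z]; it follows that all
    monomials are. *)
Definition N_normalizes (w : D) : Prop :=
  [/\ unitP w,
      forall z, unitP z -> exists z', [/\ unitP z', z == z' %[mod_N] & w * j z = j z' * w]
    & forall z, unitP z -> exists z', [/\ unitP z', z == z' %[mod_N] & j z * w = w * j z']].

Lemma N_normalizes_subgroup : unit_subgroup N_normalizes.
Proof.
split=> [w []||w y [uw wl wr] [uy yl yr]|w [uw wl wr]] //.
- split=> [|z uz|z uz]; rewrite ?unitr1 //; exists z; rewrite mulr1 mul1r;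
    by split=> //; apply: (cong_refl gN gU).
- split=> [|z uz|z uz]; first by rewrite unitrMl.
  + have [a [ua za Ea]] := yl z uz; have [b [ub ab Eb]] := wl a ua.
    exists b; split=> //; first exact: (cong_trans gN gU _ za).
    by rewrite -mulrA Ea mulrA Eb mulrA.
  + have [a [ua za Ea]] := wr z uz; have [b [ub ab Eb]] := yr a ua.
    exists b; split=> //; first exact: (cong_trans gN gU _ za).
    by rewrite mulrA Ea -mulrA Eb mulrA.
- split=> [|z uz|z uz]; rewrite ?unitrV //.
  + have [a [ua za Ea]] := wr z uz; exists a; split=> //.
    by apply: (mulrI uw); rewrite mulrA mulrV // mul1r mulrA -Ea mulrK.
  + have [a [ua za Ea]] := wl z uz; exists a; split=> //.
    by apply: (mulIr uw); rewrite mulrVK // -mulrA -Ea mulrA mulVr // mul1r.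
Qed.

Lemma variable_N_normalizes i : N_normalizes (x i).
Proof.
split=> // z uz.
  by exists (sigma i z); rewrite rmorph_unit //; split=> //; apply: sigma_cong.
have [g gK Kg] := sigma_bij i.
have ug : unitP (g z).
  have [z' [zz' z'z]] : invertible z by exists z^-1; rewrite mulrV ?mulVr.
  have inj_s := can_inj gK.
  apply/unitrP; exists (g z'); split; apply: inj_s;
    by rewrite rmorphM !Kg rmorph1.
exists (g z); split=> //; last by rewrite x_skew Kg.
by apply: (cong_sym gN gU) => //; rewrite -{2}[z]Kg; apply: sigma_cong.
Qed.

(** Conjugation by [x i] multiplies [w] by a unit of [K] congruent to [p]. Only
    the class of this unit modulo [N] is multiplicative in [w]. *)
Definition twisted i (w : D) (p : K) : Prop :=
  [/\ N_normalizes w, unitP p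
    & exists p', [/\ unitP p', p' == p %[mod_N] & x i * w = j p' * w * x i]].

Lemma twisted1 i : twisted i 1 1.
Proof.
split; rewrite ?unitr1 //; first exact: (ugrp_1 N_normalizes_subgroup).
exists 1; rewrite rmorph1 mulr1 !mul1r unitr1; split=> //.
by apply: (cong_refl gN gU); apply: unitr1.
Qed.

Lemma twistedM i w1 p1 w2 p2 :
  twisted i w1 p1 -> twisted i w2 p2 -> twisted i (w1 * w2) (p1 * p2).
Proof.
move=> [N1 u1 [p1' [u1' c1 E1]]] [N2 u2 [p2' [u2' c2 E2]]].
split; [exact: (ugrp_M N_normalizes_subgroup) | by rewrite unitrMl |].
have [_ /(_ p2' u2') [p2'' [u2'' c2'' E]] _] := N1.
exists (p1' * p2''); split; first by rewrite unitrMl.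
  apply: (cong_mul gN gU nN) => //.
  by apply: (cong_trans gN gU u2' _ c2); apply: (cong_sym gN gU).
rewrite mulrA E1 -[_ * x i * w2]mulrA E2 !mulrA -[_ * w1 * j _]mulrA E.
by rewrite mulrA rmorphM.
Qed.

Lemma twistedV i w p : twisted i w p -> twisted i w^-1 p^-1.
Proof.
move=> [Nw up [p' [up' c E]]]; have [uw wl wr] := Nw.
split; [exact: (ugrp_V N_normalizes_subgroup) | by rewrite unitrV |].
have [|a [ua ca Ea]] := wr p'^-1; first by rewrite unitrV.
exists a; split=> //.
  apply: (cong_trans gN gU (ugrp_V gU up')).
    by apply: (cong_sym gN gU) => //; rewrite unitrV.
  exact: (cong_inv gN gU nN).
have ujp : unitP (j p') by rewrite rmorph_unit.
apply: (mulrI uw); rewrite !mulrA -Ea mulrK //.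
apply: (mulIr uw); rewrite mulrVK //.
by rewrite -mulrA E mulrA -mulrA mulrA rmorphV // mulKr.
Qed.

Lemma twistedXz i w p (k : int) : twisted i w p -> twisted i (w ^ k) (p ^ k).
Proof.
move=> t; have tX m : twisted i (w ^+ m) (p ^+ m).
  by elim: m => [|m IH]; rewrite ?expr0 ?exprS; [apply: twisted1|apply: twistedM].
by case: k => m; [apply: tX | apply/twistedV/tX].
Qed.

Lemma monomial_twisted i u : twisted i (X u) (\prod_k q k i ^ u 0 k).
Proof.
rewrite /torus_monomial; elim: (index_enum _) => [|k r IH].
  by rewrite !big_nil; apply: twisted1.
rewrite !big_cons; apply: twistedM => //; apply: twistedXz.
split; [exact: variable_N_normalizes | exact: (q_unit q_inv) |].
exists (q k i); split; [exact: (q_unit q_inv) | | exact: x_comm].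
exact: (cong_refl gN gU) (q_unit q_inv _ _).
Qed.

(** If conjugation by each variable rescales [j a * X u] and [j b * X v] by
    the same factors, then modulo [N] these factors are the products of the
    [q k i ^ u k] and of the [q k i ^ v k], so that genericity gives [u = v]. *)
Lemma generic_twists : (2 <= n)%N -> generic_torus q sigma ->
  exists p : 'I_n -> 'rV[int]_n -> K,
  [/\ forall i u, unitP (p i u),
      forall i u, x i * X u = j (p i u) * X u * x i
    & forall u v a b, unitP a -> unitP b ->
      (forall i, sigma i a * p i u * a^-1 = sigma i b * p i v * b^-1) -> u = v].
Proof.
move=> n2 gen; have uq k l := q_unit q_inv k l.
have exP i u : exists p, [&& unitP p & x i * X u == j p * X u * x i].
  by have [_ _ [p [up _ ->]]] := monomial_twisted i u; exists p; rewrite up eqxx.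
pose p i u := xchoose (exP i u).
have up i u : unitP (p i u) by have /andP[] := xchooseP (exP i u).
have Ep i u : x i * X u = j (p i u) * X u * x i.
  by have /andP[_ /eqP] := xchooseP (exP i u).
exists p; split=> // u v a b ua ub eq_uv.
pose Q i (u : 'rV[int]_n) := \prod_k q k i ^ u 0 k.
have uQ i w : unitP (Q i w).
  by apply: (ugrp_prod _ gU) => k; rewrite unitrXz.
have pQ i w : p i w == Q i w %[mod_N].
  have [[uw _ _] _ [p' [_ c E]]] := monomial_twisted i w.
  suff -> : p i w = p' by [].
  apply/j_inj/(mulIr uw)/(mulIr (x_unit i)).
  by rewrite -Ep -E.
have factor i w c : unitP c -> sigma i c * p i w * c^-1 == Q i w %[mod_N].
  move=> uc; have usc : unitP (sigma i c) by rewrite rmorph_unit.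
  have step1 : sigma i c * p i w * c^-1 == p i w * sigma i c * c^-1 %[mod_N].
    apply: (cong_mul gN gU nN); rewrite ?unitrMl ?unitrV //.
      exact: commutes_torus_N.
    by apply: (cong_refl gN gU); rewrite /= unitrV.
  have step2 : p i w * sigma i c * c^-1 == p i w * c * c^-1 %[mod_N].
    apply: (cong_mul gN gU nN); rewrite ?unitrMl ?unitrV //.
      apply: (cong_mul gN gU nN) => //; first exact: (cong_refl gN gU).
      by apply: (cong_sym gN gU) => //; apply: sigma_cong.
    by apply: (cong_refl gN gU); rewrite /= unitrV.
  rewrite mulrK // in step2.
  apply: (cong_trans gN gU _ step1); first by rewrite !unitrMl ?unitrV.
  exact: (cong_trans gN gU _ step2).
apply/eqP; rewrite -subr_eq0; apply/eqP; apply: (generic_exponent_eq0 q_diag q_inv n2 gen).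
move=> i; rewrite -/(Q i (u - v)).
have ufac w c : unitP c -> unitP (sigma i c * p i w * c^-1).
  by move=> uc; rewrite !unitrMl ?unitrV // rmorph_unit.
have QQ : Q i u == Q i v %[mod_N].
  apply: (cong_trans gN gU _ _ (factor i v b ub)); first exact: ufac.
  rewrite -eq_uv; apply: (cong_sym gN gU) => //; first exact: ufac.
  exact: factor.
have QD : Q i u == Q i (u - v) * Q i v %[mod_N].
  have := @cong_monomialD K N _ gN gU nN _ (q^~ i) (uq^~ i) _
    (index_enum 'I_n) (fun k => (u - v) 0 k) (v 0).
  rewrite (eq_bigr (fun k => q k i ^ u 0 k)) => [H|k _]; last by rewrite !mxE subrK.
  by apply: H => k l; apply: commutes_torus_N.
have uQQ : unitP (Q i (u - v) * Q i v) by rewrite unitrMl.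
have : Q i (u - v) * Q i v == Q i v %[mod_N].
  exact: (cong_trans gN gU (uQ i u) (cong_sym gN gU _ _ QD)).
by rewrite /cong mulrK.
Qed.

End Twists.

(** * Valuations that are trivial on the coefficients *)

Section OrderedGroups.
Variables (d : Order.disp_t) (G : orderedGroupType d).

Lemma lt_mulg2l (z x y : G) : (x < y -> z * x < z * y)%O%g.
Proof.
rewrite !lt_neqAle => /andP[neq_xy le_xy]; rewrite le_mulg2l // andbT.
by apply: contra neq_xy => /eqP /mulgI ->.
Qed.

Lemma lt_mulg2r (z x y : G) : (x < y -> x * z < y * z)%O%g.
Proof.
rewrite !lt_neqAle => /andP[neq_xy le_xy]; rewrite le_mulg2r // andbT.
by apply: contra neq_xy => /eqP /mulIg ->.
Qed.

End OrderedGroups.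

Lemma division_ring_neq0 (K : unitRingType) : division_ring K ->
  forall a : K, (a != 0) = (a \is a GRing.unit).
Proof.
move=> divK a; apply/idP/idP; first exact: divK.
by apply: contraTneq => ->; rewrite unitr0.
Qed.

Lemma division_ring_inj (K : unitRingType) (B : nzRingType) (f : {rmorphism K -> B}) :
  division_ring K -> injective f.
Proof.
move=> divK a b eq_ab; apply/eqP; rewrite -subr_eq0; apply/negPn/negP => /divK u.
have : f ((a - b) * (a - b)^-1) = 0.
  by rewrite rmorphM rmorphB eq_ab subrr mul0r.
by rewrite mulrV // rmorph1 => /eqP; rewrite oner_eq0.
Qed.

Section ValuationTheory.
Variables (D : unitRingType) (d : Order.disp_t) (G : orderedGroupType d) (nu : D -> G).
Hypotheses (divD : division_ring D) (nuP : valuation nu).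

Lemma valuationM a b : a \is a GRing.unit -> b \is a GRing.unit ->
  nu (a * b) = (nu a * nu b)%g.
Proof. by case: nuP => _ nuM _; apply: nuM. Qed.

Lemma valuationV a : a \is a GRing.unit -> nu a^-1 = (nu a)^-1%g.
Proof.
move=> ua; have u1 := unitr1 D; have uV : a^-1 \is a GRing.unit by rewrite unitrV.
have nu1 : nu 1 = 1%g.
  by apply: (mulgI (nu 1)); rewrite -valuationM // mulr1 mulg1.
by apply: (mulgI (nu a)); rewrite -valuationM // mulrV // nu1 mulgV.
Qed.

(** The open balls of the valuation, with the convention [nu 0 = +oo]. *)
Definition above_val (g : G) (a : D) : Prop := a = 0 \/ (g < nu a)%O.

Lemma above_val_add g a b : above_val g a -> above_val g b -> above_val g (a + b).
Proof.
case=> [->|ga]; first by rewrite add0r.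
case=> [->|gb]; first by rewrite addr0; right.
have [->|a0] := eqVneq a 0; first by rewrite add0r; right.
have [->|b0] := eqVneq b 0; first by rewrite addr0; right.
have [->|ab0] := eqVneq (a + b) 0; [by left | right].
case: nuP => _ _ /(_ a b); rewrite -!(division_ring_neq0 divD).
by move=> /(_ a0 b0 ab0); apply: lt_le_trans; rewrite lt_min ga gb.
Qed.

Lemma above_val_sum g (I : eqType) (s : seq I) (F : I -> D) :
  (forall i, i \in s -> above_val g (F i)) -> above_val g (\sum_(i <- s) F i).
Proof.
elim: s => [|i s IH] Hs; first by rewrite big_nil; left.
rewrite big_cons; apply: above_val_add; first by apply: Hs; rewrite mem_head.
by apply: IH => k ks; apply: Hs; rewrite in_cons ks orbT.
Qed.

End ValuationTheory.

Section GenericValuation.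
Variables (K D : unitRingType) (j : {rmorphism K -> D}) (n : nat).
Variables (sigma : 'I_n -> {rmorphism K -> K}) (q : 'M[K]_n) (x : 'I_n -> D).
Hypotheses (divK : division_ring K) (divD : division_ring D).
Hypothesis x_unit : forall i, x i \is a GRing.unit.
Hypothesis sigma_bij : forall i, bijective (sigma i).
Hypothesis x_skew : forall i a, x i * j a = j (sigma i a) * x i.
Hypothesis q_diag : forall i, q i i = 1.
Hypothesis q_inv : forall i k, q i k * q k i = 1.
Hypothesis x_comm : forall i k, x i * x k = j (q k i) * x k * x i.
Variables (d : Order.disp_t) (G : orderedGroupType d) (nu : D -> G).
Hypotheses (nuP : valuation nu) (nu0 : vanishes_on j nu).

Local Notation X := (torus_monomial x).
Local Notation unitP a := (a \is a GRing.unit).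

Let j_inj : injective j := division_ring_inj divK.
Let nuM := valuationM nuP.

Let X_unit u : unitP (X u).
Proof. exact: (monomial_unit x_unit sigma_bij x_skew u). Qed.

Let j_unit a : a != 0 -> unitP (j a).
Proof. by move=> /divK; apply: rmorph_unit. Qed.

Lemma valuation_monomialD u v : nu (X (u + v)) = (nu (X u) * nu (X v))%g.
Proof.
have [a [b [ab ba]] E] := monomialM j_inj x_unit sigma_bij x_skew q_inv x_comm u v.
have ua : unitP a by apply/unitrP; exists b.
by rewrite -nuM // E nuM // ?rmorph_unit // nu0 // mul1g.
Qed.

Lemma valuation_term a u : a != 0 -> nu (j a * X u) = nu (X u).
Proof. by move=> a0; rewrite nuM ?j_unit // nu0 ?mul1g //; apply: divK. Qed.

Lemma above_val_scale g a z : above_val nu g z -> above_val nu g (j a * z).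
Proof.
have [->|a0] := eqVneq a 0; first by rewrite rmorph0 mul0r; left.
case=> [->|gz]; first by rewrite mulr0; left.
have [->|z0] := eqVneq z 0; first by rewrite mulr0; left.
by right; rewrite nuM ?j_unit -?division_ring_neq0 // nu0 ?mul1g //; apply: divK.
Qed.

Lemma above_val_sub g y z :
  above_val nu g y -> above_val nu g z -> above_val nu g (y - z).
Proof.
move=> gy gz; apply: above_val_add => //.
by rewrite -mulN1r -(rmorphN1 j); apply: above_val_scale.
Qed.

Lemma above_val_terms g (s : seq 'rV[int]_n) (c : 'rV[int]_n -> K) :
  (forall u, u \in s -> c u != 0 -> (g < nu (X u))%O) ->
  above_val nu g (\sum_(u <- s) j (c u) * X u).
Proof.
move=> Hs; apply: above_val_sum => // u us.
have [->|c0] := eqVneq (c u) 0; first by rewrite rmorph0 mul0r; left.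
by right; rewrite valuation_term // Hs.
Qed.

(** The values of the monomials commute, so the bound is fixed by the
    conjugation that a variable induces on the value group. *)
Lemma above_val_conj w i z : above_val nu (nu (X w)) z ->
  above_val nu (nu (X w)) (x i * z * (x i)^-1).
Proof.
case=> [->|gz]; first by rewrite mulr0 mul0r; left.
have [->|z0] := eqVneq z 0; first by rewrite mulr0 mul0r; left.
have uz : unitP z by rewrite -division_ring_neq0.
right; rewrite !nuM ?unitrMl ?unitrV // (valuationV nuP) //.
have -> : nu (X w) = (nu (x i) * nu (X w) * (nu (x i))^-1)%g.
  by rewrite -torus_monomial_delta -valuation_monomialD addrC valuation_monomialD mulgK.
exact/lt_mulg2r/lt_mulg2l.
Qed.

Hypotheses (n2 : (2 <= n)%N) (gen : generic_torus q sigma).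

(** A term [u0] not above [nu (X w)] can be eliminated by subtracting a
    [K]-multiple of the sum from one of its conjugates by a variable, and by
    genericity any other given term survives for a suitable variable, hence lies
    above [nu (X w)] by induction. Subtracting these other terms from the sum
    leaves the term [u0], which thus lies above [nu (X w)] after all. *)
Lemma generic_valuation_terms (s : seq 'rV[int]_n) (c : 'rV[int]_n -> K) w :
  uniq s -> above_val nu (nu (X w)) (\sum_(u <- s) j (c u) * X u) ->
  forall u, u \in s -> c u != 0 -> (nu (X w) < nu (X u))%O.
Proof.
have [p [up Ep sep]] := generic_twists j_inj x_unit sigma_bij x_skew q_diag
  q_inv x_comm n2 gen.
have [m] := ubnP (size s); elim: m => // m IH in s c *.
rewrite ltnS => le_sm uniq_s above_s u0 u0s c0.
rewrite ltNge; apply/negP => le_u0w.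
have uc0 : unitP (c u0) by apply: divK.
have others u : u \in rem u0 s -> c u != 0 -> (nu (X w) < nu (X u))%O.
  move=> us cu; have uc := divK cu.
  have neq_u : u != u0 by move: us; rewrite mem_rem_uniq // => /andP[].
  pose r i v := sigma i (c v) * p i v * (c v)^-1.
  have [i neq_r] : exists i, r i u != r i u0.
    apply/existsP; apply: contraNT neq_u => /existsPn Hr; apply/eqP.
    apply: (sep _ _ (c u) (c u0)) => // i.
    by apply/eqP; move: (Hr i); rewrite negbK.
  pose c' v := sigma i (c v) * p i v - r i u0 * c v.
  have c'0 : c' u0 = 0 by rewrite /c' /r mulrVK // subrr.
  apply: (IH (rem u0 s) c') => //.
  - by rewrite size_rem //; move: le_sm u0s; case: (s).
  - exact: rem_uniq.
  - have <- : x i * (\sum_(v <- s) j (c v) * X v) * (x i)^-1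
              - j (r i u0) * (\sum_(v <- s) j (c v) * X v)
            = \sum_(v <- rem u0 s) j (c' v) * X v.
      transitivity (\sum_(v <- s) j (c' v) * X v); last first.
        by rewrite (big_rem u0) //= c'0 rmorph0 mul0r add0r.
      rewrite !mulr_sumr mulr_suml -sumrB; apply: eq_bigr => v _.
      rewrite rmorphB !rmorphM mulrBl !mulrA x_skew -[_ * x i * _]mulrA Ep.
      by rewrite !mulrA mulrK.
    by apply: above_val_sub; [apply: above_val_conj | apply: above_val_scale].
  - apply: contra neq_r; rewrite subr_eq0 /r => /eqP.
    by move=> /(congr1 ( *%R^~ (c u)^-1)); rewrite -[RHS]mulrA mulrV // mulr1 => ->.
have : above_val nu (nu (X w)) (j (c u0) * X u0).
  have -> : j (c u0) * X u0 = \sum_(v <- s) j (c v) * X v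
       - \sum_(v <- rem u0 s) j (c v) * X v.
    by rewrite (big_rem u0) //= addrK.
  by apply: above_val_sub => //; apply: above_val_terms.
case=> [/eqP|].
  by apply/negP; rewrite division_ring_neq0 // unitrMl // j_unit.
by rewrite valuation_term // ltNge le_u0w.
Qed.

End GenericValuation.

(** * Lowest terms in the quantum torus *)

Section LowestTerms.
Variables (n : nat) (R : nzRingType) (q : 'M[R]_n).
Variables (sigma : 'I_n -> {rmorphism R -> R}).
Variables (T : unitRingType) (f : {rmorphism R -> T}) (x : 'I_n -> T).
Hypothesis hT : skew_quantum_torus q sigma f x.
Hypothesis domR : forall a b : R, a != 0 -> b != 0 -> a * b != 0.
Variables (d : Order.disp_t) (L : orderedGroupType d) (e : 'rV[int]_n -> L).
Hypotheses (eD : forall u v, e (u + v) = (e u * e v)%g) (e_inj : injective e).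

Local Notation X := (torus_monomial x).

(** The span of the monomials of exponent above [g], generated one term at a time
    so that sums and products are treated by induction. *)
Inductive higher (g : L) : T -> Prop :=
| higher0 : higher g 0
| higher_add u a t : (g < e u)%O -> higher g t -> higher g (f a * X u + t).

Definition lowest (t : T) (u : 'rV[int]_n) : Prop :=
  exists a h, [/\ a != 0, higher (e u) h & t = f a * X u + h].

Lemma higherD g s t : higher g s -> higher g t -> higher g (s + t).
Proof.
elim=> [|u a s' gu _ IH] ht; first by rewrite add0r.
by rewrite -addrA; apply: higher_add => //; apply: IH.
Qed.

Lemma higherN g t : higher g t -> higher g (- t).
Proof.
elim=> [|u a s gu _ IH]; first by rewrite oppr0; left.
by rewrite opprD -mulNr -rmorphN; apply: higher_add.
Qed.

Lemma higher_weaken g h t : (g <= h)%O -> higher h t -> higher g t.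
Proof.
move=> gh; elim=> [|u a s hu _ IH]; first by left.
by apply: higher_add => //; apply: le_lt_trans hu.
Qed.

Lemma termM a u b v : exists2 c, (a != 0 -> b != 0 -> c != 0) &
  f a * X u * (f b * X v) = f c * X (u + v).
Proof.
have f_inj := sqt_inj hT.
have [[xu sb] sk] := (sqt_unit hT, sqt_auto hT, sqt_skew hT).
have NX := monomial_normalizes xu sb sk u.
have [b' Eb] : exists b', X u * f b = f b' * X u by case: NX.
have [c ic Ec] := monomialM f_inj xu sb sk (sqt_inv hT) (sqt_comm hT) u v.
exists (a * b' * c).
  move=> a0 b0; apply: invertible_neq0M ic _; apply: domR => //.
  exact: (normalizes_neq0 f_inj NX Eb).
by rewrite mulrA -[f a * X u * f b]mulrA Eb !rmorphM -!mulrA Ec !mulrA.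
Qed.

Lemma higher_terml a u g t : higher g t -> higher (e u * g)%g (f a * X u * t).
Proof.
elim=> [|v b s gv _ IH]; first by rewrite mulr0; left.
have [c _ E] := termM a u b v; rewrite mulrDr E.
by apply: higher_add => //; rewrite eD; apply: lt_mulg2l.
Qed.

Lemma higher_termr a u g t : higher g t -> higher (g * e u)%g (t * (f a * X u)).
Proof.
elim=> [|v b s gv _ IH]; first by rewrite mul0r; left.
have [c _ E] := termM b v a u; rewrite mulrDl E.
by apply: higher_add => //; rewrite eD; apply: lt_mulg2r.
Qed.

Lemma higherM g h s t : higher g s -> higher h t -> higher (g * h)%g (s * t).
Proof.
move=> hs ht; elim: hs => [|v b s' gv _ IH]; first by rewrite mul0r; left.
rewrite mulrDl; apply: higherD => //.
apply: higher_weaken (higher_terml b v ht).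
exact/le_mulg2r/ltW.
Qed.

(** The freeness of the monomials applies to distinct exponents only, so equal
    ones are merged, one term at a time. *)
Lemma collect_term u a (s : seq 'rV[int]_n) (c : 'rV[int]_n -> R) : uniq s ->
  exists s' c', [/\ uniq s', {subset s' <= u :: s}
    & f a * X u + \sum_(v <- s) f (c v) * X v = \sum_(v <- s') f (c' v) * X v].
Proof.
move=> us; have [u_s|u_s] := boolP (u \in s).
  exists s, (fun v => if v == u then a + c v else c v).
  split=> // [v vs|]; first by rewrite inE vs orbT.
  rewrite !(big_rem u u_s) /= eqxx rmorphD mulrDl addrA; congr (_ + _).
  apply: eq_big_seq => v; rewrite mem_rem_uniq // => /andP[neq_vu _].
  by rewrite (negPf neq_vu).
exists (u :: s), (fun v => if v == u then a else c v); split=> //=.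
  by rewrite u_s.
rewrite big_cons eqxx; congr (_ + _); apply: eq_big_seq => v vs.
by case: eqVneq => // eq_vu; rewrite -eq_vu vs in u_s.
Qed.

Lemma higher_uniq g t : higher g t -> exists s c,
  [/\ uniq s, forall u, u \in s -> (g < e u)%O & t = \sum_(u <- s) f (c u) * X u].
Proof.
elim=> [|u a h gu _ [s [c [us gs ->]]]].
  by exists [::], (fun=> 0); rewrite big_nil.
have [s' [c' [us' sub_s' ->]]] := collect_term u a c us.
by exists s', c'; split=> // v /sub_s'; rewrite inE => /predU1P[->|/gs].
Qed.

Lemma lowest_uniq t u : lowest t u -> exists s c,
  [/\ uniq (u :: s), c u != 0, forall v, v \in s -> (e u < e v)%O
    & t = \sum_(v <- u :: s) f (c v) * X v].
Proof.
case=> a [h [a0 /higher_uniq[s [c [us gs ->]]] ->]].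
have u_s : u \notin s by apply/negP => /gs; rewrite ltxx.
exists s, (fun v => if v == u then a else c v); rewrite /= u_s eqxx; split=> //.
rewrite big_cons eqxx; congr (_ + _); apply: eq_big_seq => v vs.
by case: eqVneq => // eq_vu; rewrite -eq_vu vs in u_s.
Qed.

(** Otherwise [0] would have a lowest term, against the freeness of the
    monomials. *)
Lemma lowest_nothigher t u : lowest t u -> ~ higher (e u) t.
Proof.
move=> [a [h [a0 hh ->]]] ht.
have : lowest 0 u.
  exists a, (h - (f a * X u + h)); split=> //; last by rewrite addrA subrr.
  by apply: higherD => //; apply: higherN.
move=> /lowest_uniq[s [c [us cu _ /esym E]]].
by rewrite (sqt_free hT us E (mem_head u s)) eqxx in cu.
Qed.

Lemma lowest_higher t u g : lowest t u -> (g < e u)%O -> higher g t.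
Proof.
move=> [a [h [a0 hh ->]]] gu; apply: higher_add => //.
by apply: higher_weaken hh; apply: ltW.
Qed.

Lemma lowest_inj t u v : lowest t u -> lowest t v -> u = v.
Proof.
move=> tu tv; apply: e_inj.
case: (ltgtP (e u) (e v)) => // lt_uv; exfalso.
  exact: lowest_nothigher tu (lowest_higher tv lt_uv).
exact: lowest_nothigher tv (lowest_higher tu lt_uv).
Qed.

Lemma lowest_neq0 t u : lowest t u -> t != 0.
Proof.
by move=> tu; apply/eqP => t0; apply: (lowest_nothigher tu); rewrite t0; left.
Qed.

(** The product of the lowest terms is not zero because [R] is a domain, and all
    other products of terms are higher because [L] is an ordered group. *)
Lemma lowestM s t u v : lowest s u -> lowest t v -> lowest (s * t) (u + v).
Proof.
move=> [a [h [a0 hh ->]]] [b [k [b0 hk ->]]].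
have [c c0 E] := termM a u b v.
exists c, (f a * X u * k + h * (f b * X v) + h * k); split; first exact: c0.
  rewrite eD; apply: higherD; last exact: higherM.
  by apply: higherD; [apply: higher_terml | apply: higher_termr].
by rewrite mulrDl !mulrDr E !addrA.
Qed.

Lemma lowestD s t u v w : lowest s u -> lowest t v -> lowest (s + t) w ->
  (Order.min (e u) (e v) <= e w)%O.
Proof.
move=> su tv stw; rewrite leNgt; apply/negP; rewrite lt_min => /andP[wu wv].
by apply: (lowest_nothigher stw); apply: higherD; apply: lowest_higher; eassumption.
Qed.

Lemma lowest_term a u : a != 0 -> lowest (f a * X u) u.
Proof. by move=> a0; exists a, 0; rewrite addr0; split=> //; left. Qed.

(** The terms are first collected, so that the exponents are distinct and the
    lowest one is not cancelled. *)
Lemma lowest_exists t : t != 0 -> exists u, lowest t u.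
Proof.
have [s0 [c0 E0]] := sqt_span hT t.
have [s [c [us Et]]] : exists s c, uniq s /\ t = \sum_(u <- s) f (c u) * X u.
  rewrite {t}E0; elim: s0 => [|u s0 [s [c [us E]]]].
    by exists [::], c0; rewrite !big_nil.
  rewrite big_cons E; have [s' [c' [us' _ ->]]] := collect_term u (c0 u) c us.
  by exists s', c'.
suff [->|[u _ tu]] : t = 0 \/ exists2 u, u \in s & lowest t u.
- by rewrite eqxx.
- by exists u.
rewrite {t s0 c0 E0}Et; elim: s us => [|v s IH] /=; first by rewrite big_nil; left.
case/andP=> v_s /IH{IH}; rewrite big_cons; set h := \sum_(_ <- s) _.
have [->|cv0] := eqVneq (c v) 0.
  rewrite rmorph0 mul0r add0r => -[->|[u us hu]]; [by left | right].
  by exists u; rewrite // inE us orbT.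
case=> [->|[u us hu]]; right.
  by exists v; rewrite ?mem_head // addr0; apply: lowest_term.
case: (ltgtP (e u) (e v)) => [lt_uv|lt_vu|/e_inj eq_uv].
- have [a [k [a0 hk Ek]]] := hu; exists u; first by rewrite inE us orbT.
  exists a, (f (c v) * X v + k); split=> //; first exact: higher_add.
  by rewrite Ek addrCA.
- exists v; first exact: mem_head.
  by exists (c v), h; split=> //; apply: lowest_higher hu lt_vu.
- by rewrite -eq_uv us in v_s.
Qed.

End LowestTerms.

(** * Monomial valuations on the division ring of fractions *)

Lemma subr_telescope (V : zmodType) (a b c y z : V) :
  a + y - b - c + (z - y) = a + z - (b + c).
Proof.
rewrite [a + y - b]addrAC [a - b + y - c]addrAC -[a - b - c + y + _]addrA.
by rewrite [y + _]addrC subrK opprD addrA [a + z - b]addrAC [RHS]addrAC.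
Qed.

Section MonomialValuation.
Variables (n : nat) (R : nzRingType) (q : 'M[R]_n).
Variables (sigma : 'I_n -> {rmorphism R -> R}).
Variables (T : unitRingType) (iT : {rmorphism R -> T}) (x : 'I_n -> T).
Hypothesis hT : skew_quantum_torus q sigma iT x.
Hypothesis domR : forall a b : R, a != 0 -> b != 0 -> a * b != 0.
Variables (D : unitRingType) (iD : {rmorphism T -> D}).
Hypothesis hD : left_fraction_ring iD.
Variables (d : Order.disp_t) (L : orderedGroupType d) (e : 'rV[int]_n -> L).
Hypotheses (eD : forall u v, e (u + v) = (e u * e v)%g) (e_inj : injective e).

Local Notation X := (torus_monomial x).
Local Notation low := (lowest iT x e).

Let divD : division_ring D. Proof. by case: hD. Qed.
Let iD_inj : injective iD. Proof. by case: hD. Qed.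

Let low_inj := lowest_inj hT e_inj.
Let lowM s t u v (su : low s u) (tv : low t v) := lowestM hT domR eD su tv.
Let lowD := lowestD hT (e := e).
Let low_ex := lowest_exists hT e_inj.

Let iD_unit t : t != 0 -> iD t \is a GRing.unit.
Proof. by move=> t0; apply: divD; rewrite -(rmorph0 iD) (inj_eq iD_inj). Qed.

(** The left Ore condition in [T], obtained by writing [a / b] as a left fraction
    of [D]. *)
Lemma common_multiple (a b : T) : a != 0 -> b != 0 ->
  exists h k, [/\ h != 0, k != 0 & h * a = k * b].
Proof.
move=> a0 b0; have [_ _ frac] := hD.
have [k [h [h0 E]]] := frac (iD a * (iD b)^-1); have uh := iD_unit h0.
have ha : h * a = k * b.
  apply: iD_inj; rewrite !rmorphM; apply: (mulrI (x := (iD h)^-1)).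
    by rewrite unitrV.
  by rewrite mulKr // mulrA -E mulrVK // iD_unit.
exists h, k; split=> //; have [u lu] := low_ex a0; have [v lv] := low_ex h0.
have := lowest_neq0 hT (lowM lv lu); rewrite ha; apply: contraNneq => ->.
by rewrite mul0r.
Qed.

(** A relation rather than a function, since a fraction has many
    representations; it is functional by [fraction_exponent_inj]. *)
Definition fraction_exponent (z : D) (w : 'rV[int]_n) : Prop :=
  exists a b u v, [/\ low a u, low b v, z = (iD b)^-1 * iD a & w = u - v].

Lemma fraction_exponent_inj z w w' :
  fraction_exponent z w -> fraction_exponent z w' -> w = w'.
Proof.
move=> [a [b [u [v [au bv Ez ->]]]]] [a' [b' [u' [v' [au' bv' Ez' ->]]]]].
have [b0 b0'] := (lowest_neq0 hT bv, lowest_neq0 hT bv').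
have [h [k [h0 k0 Ehk]]] := common_multiple b0' b0.
have Ea : h * a' = k * a.
  apply: iD_inj; rewrite !rmorphM.
  have -> : iD a = iD b * z by rewrite Ez mulVKr // iD_unit.
  have -> : iD a' = iD b' * z by rewrite Ez' mulVKr // iD_unit.
  by rewrite !mulrA -!rmorphM Ehk.
have [[r hr] [s ks]] := (low_ex h0, low_ex k0).
have Eb_exp : r + v' = s + v.
  by apply: (low_inj (lowM hr bv')); rewrite Ehk; apply: lowM.
have Ea_exp : r + u' = s + u.
  by apply: (low_inj (lowM hr au')); rewrite Ea; apply: lowM.
have -> : u = r + u' - s by rewrite Ea_exp addrC addKr.
have -> : v = r + v' - s by rewrite Eb_exp addrC addKr.
by rewrite opprB addrA subrK opprD addrACA subrr add0r.
Qed.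

Lemma fraction_exponent_exists z : z != 0 -> exists w, fraction_exponent z w.
Proof.
move=> z0; have [_ _ /(_ z) [a [b [b0 Ez]]]] := hD.
have a0 : a != 0 by apply: contraNneq z0 => a0; rewrite Ez a0 rmorph0 mulr0.
have [[u au] [v bv]] := (low_ex a0, low_ex b0).
by exists (u - v), a, b, u, v.
Qed.

Lemma fraction_exponentM y z v w : fraction_exponent y v -> fraction_exponent z w ->
  fraction_exponent (y * z) (v + w).
Proof.
move=> [a [b [u1 [v1 [au bv -> ->]]]]] [a' [b' [u2 [v2 [au' bv' -> ->]]]]].
have [a0 b0'] := (lowest_neq0 hT au, lowest_neq0 hT bv').
have [h [k [h0 k0 Ehk]]] := common_multiple a0 b0'.
have [[r hr] [s ks]] := (low_ex h0, low_ex k0).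
have E_exp : r + u1 = s + v2.
  by apply: (low_inj (lowM hr au)); rewrite Ehk; apply: lowM.
have b0 := lowest_neq0 hT bv; have [uh ub ub'] := And3 (iD_unit h0) (iD_unit b0) (iD_unit b0').
exists (k * a'), (h * b), (s + u2), (r + v1); split; try exact: lowM.
  rewrite !rmorphM invrM // !mulrA; congr (_ * _).
  rewrite -!mulrA; congr (_ * _); apply: (mulrI uh); rewrite mulVKr //.
  by apply: (mulIr ub'); rewrite -mulrA mulrVK // -!rmorphM Ehk.
have -> : u1 = s + v2 - r by rewrite -E_exp addrC addKr.
exact: subr_telescope.
Qed.

(** Reduction to a common denominator, after which the minimum concerns the lowest
    terms of the numerators. *)
Lemma fraction_exponentD y z u v w :
  fraction_exponent y u -> fraction_exponent z v -> fraction_exponent (y + z) w ->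
  (Order.min (e u) (e v) <= e w)%O.
Proof.
move=> Hy Hz Hyz; move: (Hy) (Hz).
move=> [a [b [u1 [v1 [au bv Ey _]]]]] [a' [b' [u2 [v2 [au' bv' Ez _]]]]].
have [b0 b0'] := (lowest_neq0 hT bv, lowest_neq0 hT bv').
have [h [k [h0 k0 Ehk]]] := common_multiple b0 b0'.
have [[r hr] [s ks]] := (low_ex h0, low_ex k0).
have [uh uk ub ub'] := And4 (iD_unit h0) (iD_unit k0) (iD_unit b0) (iD_unit b0').
have {}Ey : y = (iD (h * b))^-1 * iD (h * a).
  by rewrite Ey !rmorphM invrM // -mulrA mulKr.
have {}Ez : z = (iD (h * b))^-1 * iD (k * a').
  by rewrite Ez Ehk !rmorphM invrM // -mulrA mulKr.
have yz0 : h * a + k * a' != 0.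
  move: Hyz; rewrite Ey Ez -mulrDr -rmorphD => -[c [c' [u' [v' [cu cv E _]]]]].
  apply: contraTneq isT => S0; move: E; rewrite S0 rmorph0 mulr0 => /esym /eqP.
  rewrite -(mulr0 (iD c')^-1).
  have uc := iD_unit (lowest_neq0 hT cv); rewrite -unitrV in uc.
  move=> /eqP /(mulrI uc) /eqP; rewrite -(rmorph0 iD) (inj_eq iD_inj).
  by rewrite (negPf (lowest_neq0 hT cu)).
have [t yzt] := low_ex yz0.
have [lhb lha lka] := And3 (lowM hr bv) (lowM hr au) (lowM ks au').
have -> : u = r + u1 - (r + v1).
  by apply: (fraction_exponent_inj Hy); exists (h * a), (h * b), (r + u1), (r + v1).
have -> : v = s + u2 - (r + v1).
  by apply: (fraction_exponent_inj Hz); exists (k * a'), (h * b), (s + u2), (r + v1).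
have -> : w = t - (r + v1).
  apply: (fraction_exponent_inj Hyz).
  exists (h * a + k * a'), (h * b), t, (r + v1); split=> //.
  by rewrite Ey Ez -mulrDr -rmorphD.
have := lowD lha lka yzt; rewrite !ge_min => /orP[] H; apply/orP; [left|right];
  by rewrite !(eD _ (- _)); apply: le_mulg2r.
Qed.

Hypothesis e_surj : forall g, exists u, e u = g.

(** The exponent of a fraction is unique, so it may be chosen for each element of
    [D]; the axioms of a valuation are then those of the exponents. *)
Lemma monomial_valuation : exists nu : D -> L, valuation nu /\
  forall a b u v, low a u -> low b v -> nu ((iD b)^-1 * iD a) = e (u - v).
Proof.
pose expo z := ClassicalEpsilon.epsilon (inhabits 0) (fraction_exponent z).
have expoP z : z \is a GRing.unit -> fraction_exponent z (expo z).
  rewrite -(division_ring_neq0 divD) => /fraction_exponent_exists.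
  exact: ClassicalEpsilon.epsilon_spec.
have expoE z w : fraction_exponent z w -> z \is a GRing.unit -> expo z = w.
  by move=> zw /expoP zw'; apply: fraction_exponent_inj zw' zw.
have fracU a b u v : low a u -> low b v -> (iD b)^-1 * iD a \is a GRing.unit.
  move=> au bv; have [a0 b0] := (lowest_neq0 hT au, lowest_neq0 hT bv).
  by rewrite unitrMl ?unitrV iD_unit.
exists (fun z => e (expo z)); split; last first.
  move=> a b u v au bv; congr e; apply: expoE; last exact: fracU au bv.
  by exists a, b, u, v.
split=> [g|y z uy uz|y z uy uz uyz].
- have [u <-] := e_surj g.
  have lX v : low (X v) v by rewrite -[X v]mul1r -(rmorph1 iT); apply/lowest_term/oner_neq0.
  (* The monomial [X 0], used as denominator, is 1. *)
  exists ((iD (X 0))^-1 * iD (X u)); first exact: fracU (lX _) (lX _).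
  congr e; apply: expoE; last exact: fracU (lX _) (lX _).
  by exists (X u), (X 0), u, 0; rewrite subr0.
- rewrite -eD; congr e; apply: expoE; last by rewrite unitrMl.
  by apply: fraction_exponentM; apply: expoP.
- by apply: (fraction_exponentD (y := y) (z := z)); apply: expoP.
Qed.

End MonomialValuation.

(** * The lexicographic refinement of a preorder on exponents *)

Section RefinedLattice.
Variables (n : nat) (d : Order.disp_t) (G : orderedGroupType d).
Variable phi : 'rV[int]_n -> G.
Hypothesis phiD : forall u v, phi (u + v) = (phi u * phi v)%g.

Definition coordinates (u : 'rV[int]_n) : seqlexi int :=
  [seq u 0 i | i <- enum 'I_n].

(** The coordinates break the ties between exponents with equal image under [phi],
    which makes the key injective and the order total. *)
Definition refined_key (u : 'rV[int]_n) :
  G *l seqlexi int :=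
  (phi u, coordinates u).

Lemma refined_key_inj : injective refined_key.
Proof.
move=> u v [_ /eq_in_map eq_uv]; apply/rowP => i.
by apply: eq_uv; rewrite mem_enum.
Qed.

Lemma coordinates_le_add2l w u v :
  (coordinates u <= coordinates v)%O -> (coordinates (w + u) <= coordinates (w + v))%O.
Proof.
rewrite /coordinates; elim: (enum _) => //= i s IH.
by rewrite !lexi_cons !mxE !lerD2l => /andP[-> /implyP H]; apply/implyP => /H.
Qed.

Lemma refined_key_le_add2l w u v :
  (refined_key u <= refined_key v)%O -> (refined_key (w + u) <= refined_key (w + v))%O.
Proof.
rewrite !lexi_pair => /andP[le_uv /implyP lex_uv].
rewrite !phiD le_mulg2l //=; apply/implyP => /(le_mulg2l (phi w)^-1%g).
by rewrite !mulKg => /lex_uv; apply: coordinates_le_add2l.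
Qed.

(** The group of exponents, written multiplicatively and ordered by [phi]
    first and lexicographically second. The type records [phi] and its
    additivity because the ordered group structure depends on them. *)
Definition refined_lattice (_ : forall u v, phi (u + v) = (phi u * phi v)%g) : Type :=
  'rV[int]_n.

Local Notation L := (refined_lattice phiD).

HB.instance Definition _ := Choice.copy L 'rV[int]_n.
HB.instance Definition _ := @monoid.isGroup.Build L (0 : 'rV[int]_n) (@GRing.opp 'rV[int]_n)
  (@GRing.add 'rV[int]_n) (@addrA _) (@add0r _) (@addr0 _) (@addNr _) (@addrN _).

Let refined_le : rel L := fun u v => (refined_key u <= refined_key v)%O.

Let refined_le_refl : reflexive refined_le.
Proof. by move=> u; apply: lexx. Qed.

Let refined_le_anti : antisymmetric refined_le.
Proof. by move=> u v /le_anti /refined_key_inj. Qed.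

Let refined_le_trans : transitive refined_le.
Proof. by move=> v u w; apply: le_trans. Qed.

Let refined_le_total : total refined_le.
Proof. by move=> u v; apply: le_total. Qed.

Fact refined_display : Order.disp_t. Proof. exact: Order.Disp tt tt. Qed.

HB.instance Definition _ := Order.Le_isPOrder.Build refined_display L
  refined_le_refl refined_le_anti refined_le_trans.
HB.instance Definition _ := Order.POrder_isTotal.Build refined_display L refined_le_total.

Let refined_mul2l (w u v : L) : (u <= v)%O -> (w * u <= w * v)%O%g.
Proof. exact: refined_key_le_add2l. Qed.

Let refined_mul2r (w u v : L) : (u <= v)%O -> (u * w <= v * w)%O%g.
Proof.
rewrite ![(_ * w)%g](addrC _ (w : 'rV[int]_n)).
exact: refined_key_le_add2l.
Qed.

HB.instance Definition _ := isOrderedGroup.Build refined_display L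
  refined_mul2l refined_mul2r.

Definition exponent_class (u : L) : G := phi u.

HB.instance Definition _ := monoid.isMultiplicative.Build L G exponent_class phiD.

Lemma exponent_class_homo : {homo exponent_class : u v / (u <= v)%O}.
Proof. by move=> u v /andP[]. Qed.

End RefinedLattice.

(** * Valuations of a generic skew quantum torus *)

(** An endomorphism of Z^n is a square integer matrix, and a one-sided inverse of
    a square matrix is two-sided. *)
Lemma surjective_additive_inj n (h : 'rV[int]_n -> 'rV[int]_n) :
  (forall u v, h (u + v) = h u + h v) -> (forall v, exists u, h u = v) -> injective h.
Proof.
move=> hD h_surj.
have h0 : h 0 = 0 by apply: (addrI (h 0)); rewrite -hD !addr0.
have hN u : h (- u) = - h u by apply: (addrI (h u)); rewrite -hD !addrN.
have hMn u m : h (u *+ m) = h u *+ m by elim: m => // m IH; rewrite !mulrS hD IH.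
have hZ (a : int) u : h (a *: u) = a *: h u.
  by rewrite -[a]intz !scaler_int; case: a => m; rewrite ?NegzE ?mulrNz ?hN -?pmulrn hMn.
pose M : 'M[int]_n := \matrix_i h (delta_mx 0 i).
have hE u : h u = u *m M.
  have hsum (I : Type) (r : seq I) (F : I -> 'rV[int]_n) :
      h (\sum_(i <- r) F i) = \sum_(i <- r) h (F i).
    by elim: r => [|i r IH]; rewrite ?big_nil // !big_cons hD IH.
  rewrite {1}(row_sum_delta u) hsum mulmx_sum_row; apply: eq_bigr => i _.
  by rewrite hZ rowK.
have [P PM] : exists P : 'M[int]_n, P *m M = 1%:M.
  have preim i : exists u, h u == delta_mx 0 i.
    by have [u <-] := h_surj (delta_mx 0 i); exists u.
  exists (\matrix_i xchoose (preim i)); apply/row_matrixP => i.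
  by rewrite row_mul rowK -hE (eqP (xchooseP (preim i))) row1.
by move=> u v; rewrite !hE => /(congr1 (mulmx^~ P)); rewrite -!mulmxA (mulmx1C PM) !mulmx1.
Qed.

Section GenericTorus.
Variables (n : nat) (n2 : (2 <= n)%N).
Variables (R : nzRingType) (hR : left_Ore_domain R).
Variables (q : 'M[R]_n) (sigma : 'I_n -> {rmorphism R -> R}).
Variables (T : unitRingType) (iT : {rmorphism R -> T}) (x : 'I_n -> T).
Hypothesis hT : skew_quantum_torus q sigma iT x.
Variables (K : unitRingType) (iK : {rmorphism R -> K}).
Hypothesis hK : left_fraction_ring iK.
Variables (D : unitRingType) (iD : {rmorphism T -> D}).
Hypothesis hD : left_fraction_ring iD.
Variables (j : {rmorphism K -> D}).
Hypothesis hj : forall r : R, j (iK r) = iD (iT r).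
Variables (sigmaK : 'I_n -> {rmorphism K -> K}).
Hypothesis hsigmaK : forall i : 'I_n, fraction_extension iK (sigma i) (sigmaK i).
Hypothesis hgen : generic_torus (map_mx iK q) sigmaK.

Let y i := iD (x i).
Local Notation Y := (torus_monomial y).

Let divK : division_ring K. Proof. by case: hK. Qed.
Let divD : division_ring D. Proof. by case: hD. Qed.
Let iK_inj : injective iK. Proof. by case: hK. Qed.
Let iD_inj : injective iD. Proof. by case: hD. Qed.
Let domR (a b : R) : a != 0 -> b != 0 -> a * b != 0. Proof. by case: hR => H _; apply: H. Qed.

Let y_unit i : y i \is a GRing.unit.
Proof. by rewrite rmorph_unit // (sqt_unit hT). Qed.

Let monomialE u : iD (torus_monomial x u) = Y u.
Proof.
rewrite rmorph_prod; apply: eq_bigr => i _.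
by rewrite rmorphXz // (sqt_unit hT).
Qed.

Let sigmaK_bij i : bijective (sigmaK i). Proof. by case: (hsigmaK i). Qed.

Let y_skew i z : y i * j z = j (sigmaK i z) * y i.
Proof.
have [_ _ frac] := hK; have [a [b [b0 ->]]] := frac z.
have [_ ->//] := hsigmaK i.
have uK c : c != 0 -> iK c \is a GRing.unit.
  by move=> c0; apply: divK; rewrite -(rmorph0 iK) (inj_eq iK_inj).
have sb0 : sigma i b != 0.
  by rewrite -(rmorph0 (sigma i)) (inj_eq (bij_inj (sqt_auto hT i))).
have skewR c : y i * j (iK c) = j (iK (sigma i c)) * y i.
  by rewrite !hj -!rmorphM (sqt_skew hT).
have uj c : c != 0 -> j (iK c) \is a GRing.unit by move=> /uK /rmorph_unit ->.
rewrite !rmorphM !rmorphV ?uK //; apply: (mulrI (uj _ sb0)).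
by rewrite !mulrA -skewR mulrK ?uj // mulrV ?uj // mul1r skewR.
Qed.

Let qK := map_mx iK q.

Let qK_diag i : qK i i = 1. Proof. by rewrite mxE (sqt_diag hT) rmorph1. Qed.
Let qK_inv i k : qK i k * qK k i = 1.
Proof. by rewrite !mxE -rmorphM (sqt_inv hT) rmorph1. Qed.
Let y_comm i k : y i * y k = j (qK k i) * y k * y i.
Proof. by rewrite mxE hj -!rmorphM (sqt_comm hT). Qed.

Section Values.
Variables (d : Order.disp_t) (G : orderedGroupType d) (nu : D -> G).
Hypotheses (nuP : valuation nu) (nu0 : vanishes_on j nu).

Definition monomial_value (u : 'rV[int]_n) : G := nu (Y u).

Lemma monomial_valueD u v :
  monomial_value (u + v) = (monomial_value u * monomial_value v)%g.
Proof. exact: (valuation_monomialD divK y_unit sigmaK_bij y_skew qK_inv y_comm nuP nu0). Qed.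

(** If the order on the exponents refines the order of their values, the term
    of lowest exponent has minimal value, so the value of the sum is at least
    that of the term, and a larger value would force all terms to be larger. *)
Lemma lowest_value (d' : Order.disp_t) (L : orderedGroupType d')
    (e : 'rV[int]_n -> L) (tau : L -> G) t u :
  {homo tau : g h / (g <= h)%O} -> (forall v, tau (e v) = monomial_value v) ->
  lowest iT x e t u -> nu (iD t) = monomial_value u.
Proof.
move=> tau_homo tau_e tu; have [s [c [us cu es Et]]] := lowest_uniq tu.
have iDt : iD t = \sum_(v <- u :: s) j (iK (c v)) * Y v.
  rewrite Et rmorph_sum; apply: eq_bigr => v _.
  by rewrite rmorphM hj monomialE.
have cK v : c v != 0 -> iK (c v) != 0.
  by rewrite -(rmorph0 iK) (inj_eq iK_inj).
have iDt0 : iD t != 0.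
  by rewrite -(rmorph0 iD) (inj_eq iD_inj) (lowest_neq0 hT tu).
have ge_u v : v \in u :: s -> (monomial_value u <= monomial_value v)%O.
  rewrite inE => /predU1P[->|/es lt_uv]; first exact: lexx.
  by rewrite -!tau_e tau_homo // ltW.
case: (ltgtP (nu (iD t)) (monomial_value u)) => // [lt_nu|gt_nu].
  have : above_val nu (nu (iD t)) (iD t).
    rewrite {2}iDt; apply: (above_val_terms divK divD y_unit sigmaK_bij y_skew nuP nu0).
    by move=> v vs _; apply: lt_le_trans lt_nu (ge_u v vs).
  by case=> [/eqP|]; [rewrite (negPf iDt0) | rewrite ltxx].
have above_t : above_val nu (monomial_value u) (\sum_(v <- u :: s) j (iK (c v)) * Y v).
  by rewrite -iDt; right.
have := generic_valuation_terms divK divD y_unit sigmaK_bij y_skew qK_diag qK_inv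
  y_comm nuP nu0 n2 hgen us above_t (mem_head u s) (cK _ cu).
by rewrite ltxx.
Qed.

Let L := refined_lattice monomial_valueD.
Let e : 'rV[int]_n -> L := id.
Let tau : {multiplicative L -> G} := @exponent_class _ _ _ _ monomial_valueD.

Let e_inj : injective e. Proof. by []. Qed.

Lemma fraction_value a b u v : lowest iT x e a u -> lowest iT x e b v ->
  nu ((iD b)^-1 * iD a) = monomial_value (u - v).
Proof.
move=> au bv.
have low t w : lowest iT x e t w -> nu (iD t) = monomial_value w.
  by apply: (lowest_value (tau := tau)) => //; apply: exponent_class_homo.
have iDu t w : lowest iT x e t w -> iD t \is a GRing.unit.
  move=> /(lowest_neq0 hT) t0; apply: divD.
  by rewrite -(rmorph0 iD) (inj_eq iD_inj).
have [ua ub] := (iDu _ _ au, iDu _ _ bv).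
rewrite (valuationM nuP) ?unitrV // (valuationV nuP) // (low _ _ au) (low _ _ bv).
by apply: (mulgI (monomial_value v)); rewrite mulVKg -monomial_valueD addrC subrK.
Qed.

(** Every element of [D] is a fraction, whose numerator and denominator have the
    values of their lowest monomials. *)
Lemma monomial_value_surj g : exists u, monomial_value u = g.
Proof.
have [/(_ g) [z uz <-] _ _] := nuP; have [_ _ /(_ z) [a [b [b0 Ez]]]] := hD.
have a0 : a != 0.
  by apply: contraTneq uz => a0; rewrite Ez a0 rmorph0 mulr0 unitr0.
have [[u au] [v bv]] := (lowest_exists hT e_inj a0, lowest_exists hT e_inj b0).
by exists (u - v); rewrite Ez (fraction_value au bv).
Qed.

(** A valuation is refined by the monomial valuation of the lexicographic
    refinement of its values on the monomials, whose group is Z^n. *)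
Lemma maximal_rank_lattice : maximal_rank j nu -> isomorphic_to_Zn G n.
Proof.
have [nu1 [nu1P nu1E]] : exists nu1 : D -> L, valuation nu1 /\
    forall a b u v, lowest iT x e a u -> lowest iT x e b v ->
      nu1 ((iD b)^-1 * iD a) = e (u - v).
  by apply: (monomial_valuation hT domR hD) => // g; exists g.
have nu1_0 : vanishes_on j nu1.
  move=> z uz; have [_ _ /(_ z) [a [b [b0 Ez]]]] := hK.
  have a0 : a != 0.
    by apply: contraTneq uz => a0; rewrite Ez a0 rmorph0 mulr0 unitr0.
  have low c : c != 0 -> lowest iT x e (iT c) 0.
    move=> c0; have := lowest_term iT x e 0 c0.
    by rewrite torus_monomial0 mulr1.
  have ub : iK b \is a GRing.unit by apply: divK; rewrite -(rmorph0 iK) (inj_eq iK_inj).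
  by rewrite Ez rmorphM rmorphV // !hj (nu1E _ _ _ _ (low a a0) (low b b0)) subrr.
have tau_ge : valuation_ge_via nu1 nu tau.
  split; first by split; [apply: exponent_class_homo | apply: monomial_value_surj].
  move=> z uz; have [_ _ /(_ z) [a [b [b0 Ez]]]] := hD.
  have a0 : a != 0.
    by apply: contraTneq uz => a0; rewrite Ez a0 rmorph0 mulr0 unitr0.
  have [[u au] [v bv]] := (lowest_exists hT e_inj a0, lowest_exists hT e_inj b0).
  by rewrite Ez (fraction_value au bv) (nu1E _ _ _ _ au bv).
move=> /(_ _ _ _ _ nu1P nu1_0 tau_ge) [_ [tau' [_ tauK tau'K]]].
exists (tau' : G -> 'rV[int]_n); split; first by exists (tau : 'rV[int]_n -> G).
by move=> a b; rewrite gmulfM.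
Qed.

Lemma monomial_value_inj : isomorphic_to_Zn G n -> injective monomial_value.
Proof.
case=> f [f_bij fM].
have h_inj : injective (f \o monomial_value).
  apply: surjective_additive_inj => [u v|v] /=.
    by rewrite monomial_valueD fM.
  have [g _ gK] := f_bij; have [u Eu] := monomial_value_surj (g v).
  by exists u; rewrite Eu gK.
exact: inj_compr h_inj.
Qed.

End Values.

(** The value group of any valuation above [nu] is also a quotient of Z^n, so
    it cannot grow once the value group of [nu] is itself isomorphic to Z^n. *)
Lemma lattice_maximal_rank (d : Order.disp_t) (G : orderedGroupType d) (nu : D -> G) :
  valuation nu -> vanishes_on j nu -> isomorphic_to_Zn G n -> maximal_rank j nu.
Proof.
move=> nuP nu0 /(monomial_value_inj nuP nu0) mv_inj d1 G1 nu1 tau nu1P nu1_0.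
case=> -[tau_homo tau_surj] tau_nu; split=> //.
have Y_unit u : Y u \is a GRing.unit.
  exact: (monomial_unit y_unit sigmaK_bij y_skew).
have tau_inj : injective tau.
  move=> g h; have [u <-] := monomial_value_surj nu1P nu1_0 g.
  have [v <-] := monomial_value_surj nu1P nu1_0 h.
  by rewrite !tau_nu // => /mv_inj ->.
have preim g : exists u, monomial_value nu u == g.
  by have [u <-] := monomial_value_surj nuP nu0 g; exists u.
pose tau' g := monomial_value nu1 (xchoose (preim g)).
have tau'K : cancel tau' tau.
  by move=> g; rewrite /tau' tau_nu //; apply/eqP/(xchooseP (preim g)).
have tauK : cancel tau tau' by move=> g; apply: tau_inj; rewrite tau'K.
have tau'M : {morph tau' : g h / (g * h)%g >-> (g * h)%g}.
  by move=> g h; apply: tau_inj; rewrite gmulfM !tau'K.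
pose tau'm := HB.pack_for {multiplicative G -> G1} tau'
  (monoid.isMultiplicative.Build _ _ _ tau'M).
exists tau'm; split=> // g h le_gh; rewrite leNgt; apply/negP => lt_hg.
have := tau_homo _ _ (ltW lt_hg); rewrite !tau'K => le_hg.
by move: lt_hg; rewrite (le_anti (introT andP (conj le_gh le_hg))) ltxx.
Qed.

End GenericTorus.

Theorem theorem3p30 (n : nat) (hn : (2 <= n)%N)
    (R : nzRingType) (hR : left_Ore_domain R)
    (q : 'M[R]_n) (sigma : 'I_n -> {rmorphism R -> R})
    (T : unitRingType) (iT : {rmorphism R -> T}) (x : 'I_n -> T)
    (hT : skew_quantum_torus q sigma iT x)
    (K : unitRingType) (iK : {rmorphism R -> K})
    (hK : left_fraction_ring iK)
    (D : unitRingType) (iD : {rmorphism T -> D})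
    (hD : left_fraction_ring iD)
    (j : {rmorphism K -> D}) (hj : forall r : R, j (iK r) = iD (iT r))
    (sigmaK : 'I_n -> {rmorphism K -> K})
    (hsigmaK : forall i : 'I_n, fraction_extension iK (sigma i) (sigmaK i))
    (d : Order.disp_t) (G : orderedGroupType d) (nu : D -> G)
    (hnu : valuation nu) (hnu0 : vanishes_on j nu)
    (hgen : generic_torus (map_mx iK q) sigmaK) :
  maximal_rank j nu <-> isomorphic_to_Zn G n.
Proof.
split; first exact: (maximal_rank_lattice hn hR hT hK hD hj hsigmaK hgen hnu hnu0).
exact: (lattice_maximal_rank hn hT hK hD hj hsigmaK hgen hnu hnu0).
Qed.
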